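(* Let $X$ be a real Banach space and let $Y$ be a closed subspace of $X$ such that every separable (closed) subspace of $Y$ has property-$(U)$ in $X$. Then $Y$ has property-$(U)$ in $X$.
   Context: A closed subspace $Y$ of $X$ has property-$(U)$ in $X$ if every bounded linear functional on $Y$ has a unique norm-preserving extension to $X$. *)

(* Defs.v *)
From HB Require Import structures.
From mathcomp Require Import all_boot all_order all_algebra.
From mathcomp Require Import all_classical all_reals all_analysis.

Set Implicit Arguments.
Unset Strict Implicit.
Unset Printing Implicit Defensive.

Import Order.TTheory GRing.Theory Num.Theory.
Import numFieldNormedType.Exports.

Local Open Scope classical_set_scope.
Local Open Scope ring_scope.

Section property_U.
Context {R : realType} {X : normedModType R}.
Implicit Types (Y Z D : set X) (f g : X -> R).

Definition closed_subspace Y : Prop :=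
  GRing.submod_closed (mem Y) /\ closed Y.

Definition separable_set Z : Prop :=
  exists D, [/\ countable D, D `<=` Z & Z `<=` closure D].

(* A functional on a subspace Y is represented by a total function X -> R,
   of which only the values on Y matter. *)
Definition bounded_functional_on Y f : Prop :=
  (forall (a : R) x y, Y x -> Y y -> f (a *: x + y) = a * f x + f y) /\
  (exists M : R, forall y, Y y -> `|f y| <= M * `|y|).

(* The supremum is meaningful for functionals that are bounded on Y: sup is 0
   by convention on sets that are not bounded above. *)
Definition functional_norm_on Y f : R :=
  sup [set `|f y| | y in [set y | Y y /\ `|y| <= 1]].

Definition norm_preserving_extension Y f g : Prop :=
  [/\ bounded_functional_on [set: X] g,
      forall y, Y y -> g y = f y &
      functional_norm_on [set: X] g = functional_norm_on Y f].

Definition property_U Y : Prop :=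
  forall f, bounded_functional_on Y f ->
    exists! g, norm_preserving_extension Y f g.

End property_U.

(* Main.v *)
Require Import Defs.
From mathcomp Require Import all_boot all_order all_algebra.
From mathcomp Require Import all_classical all_reals all_analysis.
Import numFieldNormedType.Exports.
Local Open Scope classical_set_scope.
Local Open Scope ring_scope.

Import Order.TTheory GRing.Theory Num.Theory.

(** Both existence and uniqueness of the extension are read off from separable
subspaces of [Y].

Let [f] be a bounded functional on [Y].  The norm of [f] is a supremum, so it
is already approached along a sequence [u] in the unit ball of [Y]
([norming_sequence]).  Consequently every subspace between the closed linear
span [Z] of [u] and [Y] gives [f] the same norm as [Y] does, and any
norm-preserving extension of [f] from such a subspace is also one from any
smaller such subspace ([norm_preserving_extensionS]).  The subspace [Z] is
separable, so [f] restricted to [Z] has exactly one norm-preserving extension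
[g].

Uniqueness: a norm-preserving extension of [f] from [Y] is one from [Z], hence
is [g].

Existence: it remains to see that [g] agrees with [f] at every [y] in [Y].  The
closed span [W] of [u] together with [y] is separable too, so [f] restricted to
[W] has a norm-preserving extension [h].  Then [h] also extends [f] from [Z]
without increasing the norm, so [h = g], and therefore [g y = h y = f y].

The remaining work is to know that the closed span of a sequence is a separable
closed subspace.  It is obtained as the closure of the rational linear
combinations, which makes separability immediate and turns stability under real
linear combinations into a density argument ([closed_span_linear]). *)

(** * Closed spans of sequences *)

Section RationalSpan.
Context {R : realType} {X : normedModType R}.
Implicit Types (u v : nat -> X) (S Y Z : set X) (f : X -> R).

Definition rat_comb u (s : seq (rat * nat)) : X :=
  \sum_(p <- s) (ratr p.1 : R) *: u p.2.

(** Rational coefficients are enough for the closure to be the closed real linear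
span: it is a closed subspace and the least one containing the sequence
([closed_span_closed_subspace], [closed_span_min]). *)
Definition closed_span u : set X := closure (range (rat_comb u)).

Lemma rat_combP u (q : rat) (s t : seq (rat * nat)) :
  exists r, rat_comb u r = (ratr q : R) *: rat_comb u s + rat_comb u t.
Proof.
exists ([seq (q * p.1, p.2) | p <- s] ++ t).
rewrite /rat_comb big_cat big_map scaler_sumr; congr (_ + _).
by apply: eq_bigr => p _; rewrite rmorphM scalerA.
Qed.

Lemma closure_preimage_sub {T U : topologicalType} {h : T -> U}
    {A : set T} {B : set U} :
  continuous h -> closed B -> (forall x, A x -> B (h x)) ->
  forall x, closure A x -> B (h x).
Proof.
move=> + Bc.
move=> /continuous_closedP/(_ _ Bc)/closure_id E AB.
by move=> x /(closureS AB); rewrite -E.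
Qed.

(** The map [(a, x, y) |-> a *: x + y] is separately continuous and sends
rational scalars and rational combinations to rational combinations.  Passing
to the closure in one variable at a time, in the order [y], [x], [a], reaches
every real scalar and all points of the closed span. *)
Lemma closed_span_linear u (a : R) (x y : X) :
  closed_span u x -> closed_span u y -> closed_span u (a *: x + y).
Proof.
have cZ : closed (closed_span u) by exact: closed_closure.
move=> + Zy.
have cl (b : R) (z : X) : continuous (fun w : X => b *: w + z).
  by move=> w; apply: cvgD; [exact: scaler_continuous | exact: cvg_cst].
have step1 q s : closed_span u ((ratr q : R) *: rat_comb u s + y).
  rewrite addrC -[X in X + _]scale1r.
  apply: (closure_preimage_sub (cl 1 _) cZ) Zy => _ [t _ <-].
  rewrite scale1r addrC; have [r <-] := rat_combP u q s t.
  by apply: subset_closure; exists r.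
have step2 q z : closed_span u z -> closed_span u ((ratr q : R) *: z + y).
  by apply: (closure_preimage_sub (cl _ _) cZ) => _ [s _ <-].
move=> Zx.
have ca : closure (range (ratr : rat -> R)) a.
  move=> B /nbhs_interior/nbhs_singleton Ba.
  have [c [/interior_subset Bc ratc]] :=
    dense_rat (ex_intro _ a Ba) (@open_interior _ B).
  by exists c.
apply: (closure_preimage_sub (h := fun b : R => b *: x + y) _ cZ _ _ ca).
  by move=> b; apply: cvgD; [exact: scalel_continuous | exact: cvg_cst].
by move=> _ [q _ <-]; exact: step2.
Qed.

Lemma closed_span0 u : closed_span u 0.
Proof. by apply: subset_closure; exists [::] => //; rewrite /rat_comb big_nil. Qed.

Lemma closed_span_mem u n : closed_span u (u n).
Proof.
apply: subset_closure; exists [:: (1%Q, n)] => //.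
by rewrite /rat_comb big_seq1 rmorph1 scale1r.
Qed.

Lemma closed_span_closed_subspace u : closed_subspace (closed_span u).
Proof.
split; last exact: closed_closure.
split=> [|a x y]; rewrite !inE; first exact: closed_span0.
exact: closed_span_linear.
Qed.

Lemma closed_span_separable u : separable_set (closed_span u).
Proof.
exists (range (rat_comb u)); split=> //; last exact: subset_closure.
by apply: sub_countable (card_image_le _ _) _; exact: countableP.
Qed.

Lemma closed_span_min u Z : closed_subspace Z -> (forall n, Z (u n)) ->
  closed_span u `<=` Z.
Proof.
move=> [[Z0 Zl] cZ] Zu x /closureS; move=> /(_ Z) H.
move/closure_id: cZ => ->; apply: H => _ [s _ <-].
elim: s => [|p s IH]; first by rewrite /rat_comb big_nil; rewrite inE in Z0.
rewrite /rat_comb big_cons; have := Zl (ratr p.1) (u p.2) (rat_comb u s).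
by rewrite !inE; apply.
Qed.

End RationalSpan.

(** * Sequences that carry the norm of a functional *)

Section NormingSequence.
Context {R : realType} {X : normedModType R}.
Implicit Types (Y Z : set X) (f g : X -> R).

Lemma bounded_functional_onS Y Z f : Z `<=` Y ->
  bounded_functional_on Y f -> bounded_functional_on Z f.
Proof.
move=> ZY [fl [M fM]]; split=> [a x y /ZY Yx /ZY Yy|]; first exact: fl.
by exists M => y /ZY; exact: fM.
Qed.

(** Ensures that [functional_norm_on] is a genuine least upper bound, not the
conventional value 0 of [sup]. *)
Lemma unit_values_has_sup Y f : Y 0 -> bounded_functional_on Y f ->
  has_sup [set `|f y| | y in [set y | Y y /\ `|y| <= 1]].
Proof.
move=> Y0 [_ [M fM]]; split.
  by exists `|f 0|; exists 0 => //=; rewrite normr0 ler01.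
exists `|M| => _ [y [Yy y1] <-]; apply: (le_trans (fM y Yy)).
apply: (le_trans (ler_norm _)); rewrite normrM normr_id.
by rewrite -[leRHS]mulr1 ler_wpM2l.
Qed.

(** Choose [u n] in the unit ball of [Y] with [`|f (u n)|] within [1 / (n + 1)] of
the norm of [f].  A set [Z] containing all [u n] then sees a norm at least that
of [f] on [Y], and no more than it because [Z] lies in [Y].  One sequence serves
all [Z] at once, which is what allows [Z] to be enlarged by a further point. *)
Lemma norming_sequence Y f : Y 0 -> bounded_functional_on Y f ->
  exists u : nat -> X, (forall n, Y (u n)) /\
    forall Z, Z 0 -> Z `<=` Y -> (forall n, Z (u n)) ->
      functional_norm_on Z f = functional_norm_on Y f.
Proof.
move=> Y0 fY; have supY := unit_values_has_sup _ _ Y0 fY.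
have /choice[u uP] n : exists y, [/\ Y y, `|y| <= 1 &
    functional_norm_on Y f - n.+1%:R^-1 < `|f y|].
  have [|_ [y [Yy y1] <-] lt_fy] := sup_adherent _ supY (eps := n.+1%:R^-1).
    by rewrite invr_gt0.
  by exists y.
exists u; split=> [n|Z Z0 ZY Zu]; first by have [] := uP n.
have supZ := unit_values_has_sup _ _ Z0 (bounded_functional_onS _ _ _ ZY fY).
apply/eqP; rewrite eq_le; apply/andP; split.
  apply: ge_sup; first by case: supZ.
  move=> _ [y [/ZY Yy y1] <-]; apply: ub_le_sup; first by case: supY.
  by exists y.
apply/ler_addgt0Pr => e e0.
have [n lt_ne] : exists n : nat, n.+1%:R^-1 < e.
  by have [n ne] := ltr_add_invr (y := 0) e0; exists n; rewrite add0r in ne.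
have [_ u1 lt_fu] := uP n.
have fuZ : `|f (u n)| <= functional_norm_on Z f.
  by apply: ub_le_sup; [case: supZ | exists (u n)].
rewrite -lerBlDr; apply: le_trans fuZ; apply: le_trans (ltW lt_fu).
by rewrite lerB // ltW.
Qed.

(** The equality of the two norms is what makes restriction to a smaller set
harmless: in general the restriction of [f] may have a smaller norm, which [g]
would not preserve. *)
Lemma norm_preserving_extensionS {Y Z f g} : Z `<=` Y ->
  functional_norm_on Z f = functional_norm_on Y f ->
  norm_preserving_extension Y f g -> norm_preserving_extension Z f g.
Proof. by move=> ZY fZY [gb gf gn]; split=> // [y /ZY /gf|]; rewrite ?fZY. Qed.

End NormingSequence.

Theorem proposition2p15 (R : realType) (X : completeNormedModType R)
    (Y : set X) (hY : closed_subspace Y)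
    (hsep : forall Z : set X, closed_subspace Z -> Z `<=` Y ->
      separable_set Z -> property_U Z) :
  property_U Y.
Proof.
move=> f fY; have Y0 : Y 0 by case: hY => -[+ _] _; rewrite inE.
have [u [Yu fu]] := norming_sequence _ _ Y0 fY.
have spanU v : (forall n, Y (v n)) ->
    closed_span v `<=` Y /\ property_U (closed_span v).
  move=> Yv; have ZY := closed_span_min _ _ hY Yv.
  split=> //; apply: hsep ZY _; first exact: closed_span_closed_subspace.
  exact: closed_span_separable.
have [ZY /(_ f (bounded_functional_onS _ _ _ ZY fY))[g [gZ g_uniq]]] := spanU u Yu.
have fZ := fu _ (closed_span0 u) ZY (closed_span_mem u).
(* The second goal is uniqueness: [g'] restricts to an extension from [Z]. *)
exists g; split=> [|g' /(norm_preserving_extensionS ZY fZ)]; last exact: g_uniq.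
have [gb _ gn] := gZ; split=> // [y Yy|]; last by rewrite gn.
(* The point [y] is put in front of [u], so that one sequence spans both. *)
pose v n := if n is m.+1 then u m else y.
have [WY /(_ f (bounded_functional_onS _ _ _ WY fY))[h [hW _]]] :
  closed_span v `<=` Y /\ property_U (closed_span v) by apply: spanU; case.
have Wu n : closed_span v (u n) by exact: closed_span_mem v n.+1.
have ZW : closed_span u `<=` closed_span v.
  by apply: closed_span_min Wu; exact: closed_span_closed_subspace.
have fW := fu _ (closed_span0 v) WY Wu.
rewrite (g_uniq h); first by have [_ -> //] := hW; exact: closed_span_mem v 0%N.
by apply: norm_preserving_extensionS ZW _ hW; rewrite fZ fW.
Qed.
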